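(* Let $f\colon\mathbb{R}^d\to\mathbb{R}$ be a piecewise affine function that is bounded below. Then $f$ attains a global minimum, and the method of global codifferential descent (MGCD), applied to $f$, finds a point of global minimum of $f$ in a finite number of steps (that is, the MGCD terminates after finitely many iterations, and the iterate $x_n$ at which it terminates is a point of global minimum of $f$).
   Context: **Piecewise affine functions.** A polyhedral set is the intersection of finitely many closed halfspaces. A finite family $\{Q_1,\dots,Q_k\}$ of polyhedral sets is a polyhedral partition of $\mathbb{R}^d$ if $\mathbb{R}^d=\bigcup_iQ_i$, each $Q_i$ has nonempty interior, and the interiors are mutually disjoint. $f\colon\mathbb{R}^d\to\mathbb{R}$ is piecewise affine if there is a polyhedral partition of $\mathbb{R}^d$ such that the restriction of $f$ to each of its members is affine. Every piecewise affine function can be written (known theorem of Gorokhovik and Zorko) as $$f=\underline{f}+\overline{f},\quad\underline{f}(x)=\max_{i\in I}(a_i+\langle v_i,x\rangle),\quad\overline{f}(x)=\min_{j\in J}(b_j+\langle w_j,x\rangle),$$ with $I=\{1,\dots,l\}$, $J=\{1,\dots,s\}$, $(a_i,v_i),(b_j,w_j)\in\mathbb{R}\times\mathbb{R}^d$. Fix such a representation. **Notation.** $\mathbb{R}\times\mathbb{R}^d$ has the norm $\|(a,v)\|^2=a^2+\|v\|^2$; $\operatorname{co}$ is the convex hull. For $x\in\mathbb{R}^d$, $j\in J$: $$\underline{d}f(x)=\operatorname{co}\{(a_i-\underline{f}(x)+\langle v_i,x\rangle,\,v_i)\mid i\in I\},\qquad z_j(x)=(b_j-\overline{f}(x)+\langle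 w_j,x\rangle,\,w_j),$$ and $(a_j(x),v_j(x))$ denotes the unique minimizer of $\|(a,v)\|^2$ over $(a,v)\in\underline{d}f(x)+z_j(x)$. **MGCD.** Step 1: choose a starting point $x_0\in\mathbb{R}^d$; set $M:=J$, $n:=0$. Step 2: compute $\underline{d}f(x_n)$ and $z_j(x_n)$ for all $j\in M$. Step 3: for every $j\in M$ compute $(a_j(x_n),v_j(x_n))$; if $a_j(x_n)\ge0$, remove $j$ from $M$. Step 4: if $M=\emptyset$, stop. Otherwise choose $j(n)\in M$ minimizing $f\big(x_n+\frac{1}{a_j(x_n)}v_j(x_n)\big)$ over $j\in M$; set $x_{n+1}=x_n+\frac{1}{a_{j(n)}(x_n)}v_{j(n)}(x_n)$, $n:=n+1$, and go to Step 2. *)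

(* Defs.v *)
From HB Require Import structures.
From mathcomp Require Import all_boot all_order all_algebra.
From mathcomp Require Import all_classical all_reals all_analysis.

Set Implicit Arguments.
Unset Strict Implicit.
Unset Printing Implicit Defensive.

Import Order.TTheory GRing.Theory Num.Theory.
Import numFieldNormedType.Exports.

Local Open Scope classical_set_scope.
Local Open Scope ring_scope.

Definition dot (R : realType) (d : nat) (u x : 'rV[R]_d) : R :=
  \sum_(k < d) u 0 k * x 0 k.

Definition closed_halfspace (R : realType) (d : nat) (H : set 'rV[R]_d) : Prop :=
  exists c : 'rV[R]_d, exists t : R,
    c != 0 /\ H = [set x : 'rV[R]_d | dot c x <= t].

(* m = 0 gives the whole space. *)
Definition polyhedral_set (R : realType) (d : nat) (Q : set 'rV[R]_d) : Prop :=
  exists m : nat, exists H : 'I_m -> set 'rV[R]_d,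
    (forall k, closed_halfspace (H k)) /\ Q = \bigcap_(k in [set: 'I_m]) H k.

Definition polyhedral_partition (R : realType) (d k : nat)
    (Q : 'I_k -> set 'rV[R]_d) : Prop :=
  [/\ forall i, polyhedral_set (Q i),
      \bigcup_(i in [set: 'I_k]) Q i = [set: 'rV[R]_d],
      forall i, interior (Q i) !=set0 &
      forall i j, i != j -> interior (Q i) `&` interior (Q j) = set0].

Definition piecewise_affine (R : realType) (d : nat) (f : 'rV[R]_d -> R) : Prop :=
  exists k : nat, exists2 Q : 'I_k -> set 'rV[R]_d, polyhedral_partition Q &
    forall i, exists a : R, exists v : 'rV[R]_d,
      forall x, Q i x -> f x = a + dot v x.

(* The data (a_i, v_i), i in I, and (b_j, w_j), j in J. The index sets are
   nonempty: I has rep_l.+1 elements and J has rep_s.+1 elements. *)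
Record max_min_rep (R : realType) (d : nat) := MaxMinRep {
  rep_l : nat;
  rep_s : nat;
  rep_a : 'I_rep_l.+1 -> R;
  rep_v : 'I_rep_l.+1 -> 'rV[R]_d;
  rep_b : 'I_rep_s.+1 -> R;
  rep_w : 'I_rep_s.+1 -> 'rV[R]_d }.

Arguments rep_a {R d} r i : rename.
Arguments rep_v {R d} r i : rename.
Arguments rep_b {R d} r j : rename.
Arguments rep_w {R d} r j : rename.

(* The default value of each iterated max/min is the term of index 0, so it
   does not affect the result. *)
Definition lower_part (R : realType) (d : nat) (r : max_min_rep R d)
    (x : 'rV[R]_d) : R :=
  \big[Order.max/(rep_a r ord0 + dot (rep_v r ord0) x)]_(i < (rep_l r).+1)
    (rep_a r i + dot (rep_v r i) x).

Definition upper_part (R : realType) (d : nat) (r : max_min_rep R d)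
    (x : 'rV[R]_d) : R :=
  \big[Order.min/(rep_b r ord0 + dot (rep_w r ord0) x)]_(j < (rep_s r).+1)
    (rep_b r j + dot (rep_w r j) x).

Definition represents (R : realType) (d : nat) (r : max_min_rep R d)
    (f : 'rV[R]_d -> R) : Prop :=
  forall x, f x = lower_part r x + upper_part r x.

(* R^o carries the module structure of R over itself, which makes the product
   a left module over R. *)
Definition codiff_space (R : realType) (d : nat) : lmodType R :=
  (R^o * 'rV[R]_d)%type.

Definition sqnorm (R : realType) (d : nat) (p : codiff_space R d) : R :=
  p.1 ^+ 2 + dot p.2 p.2.

Definition convex_hull (R : realType) (V : lmodType R) (n : nat) (p : 'I_n -> V)
  : set V :=
  [set q | exists t : 'I_n -> R,
    [/\ forall i, 0 <= t i, \sum_(i < n) t i = 1 &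
        q = \sum_(i < n) t i *: p i]].

Definition hypodiff (R : realType) (d : nat) (r : max_min_rep R d)
    (x : 'rV[R]_d) : set (codiff_space R d) :=
  convex_hull (fun i : 'I_(rep_l r).+1 =>
    (rep_a r i - lower_part r x + dot (rep_v r i) x, rep_v r i)
      : codiff_space R d).

Definition hyper_point (R : realType) (d : nat) (r : max_min_rep R d)
    (j : 'I_(rep_s r).+1) (x : 'rV[R]_d) : codiff_space R d :=
  (rep_b r j - upper_part r x + dot (rep_w r j) x, rep_w r j).

Arguments hyper_point {R d} r j x.

Definition is_min_norm (R : realType) (d : nat) (S : set (codiff_space R d))
    (p : codiff_space R d) : Prop :=
  S p /\ forall q, S q -> sqnorm p <= sqnorm q.

(* The pair (a_j(x), v_j(x)). The set minimized over is nonempty, compact and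
   convex, so the minimizer exists and is unique; the default value 0 of xget
   is not used. *)
Definition min_norm_point (R : realType) (d : nat) (r : max_min_rep R d)
    (j : 'I_(rep_s r).+1) (x : 'rV[R]_d) : codiff_space R d :=
  xget 0 (is_min_norm [set p + hyper_point r j x | p in hypodiff r x]).

Arguments min_norm_point {R d} r j x.

Definition mgcd_next (R : realType) (d : nat) (r : max_min_rep R d)
    (j : 'I_(rep_s r).+1) (x : 'rV[R]_d) : 'rV[R]_d :=
  x + (min_norm_point r j x).1^-1 *: (min_norm_point r j x).2.

Arguments mgcd_next {R d} r j x.

Definition mgcd_prune (R : realType) (d : nat) (r : max_min_rep R d)
    (M : {set 'I_(rep_s r).+1}) (x : 'rV[R]_d) : {set 'I_(rep_s r).+1} :=
  (M :\: [set j | 0 <= (min_norm_point r j x).1])%SET.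

Arguments mgcd_prune {R d} r M x.

(* x n is the n-th iterate and M n the index set before the removals made at
   x n; removed indices are never restored.
   The index j(n) is any minimizer, so a starting point may have several runs.
   A run stops at the first n where the pruned set is empty; the values of x
   and M beyond that n are irrelevant. *)
Definition mgcd_run (R : realType) (d : nat) (f : 'rV[R]_d -> R)
    (r : max_min_rep R d) (x0 : 'rV[R]_d) (x : nat -> 'rV[R]_d)
    (M : nat -> {set 'I_(rep_s r).+1}) : Prop :=
  [/\ x 0%N = x0,
      M 0%N = [set: 'I_(rep_s r).+1]%SET &
      forall n, (forall m, (m <= n)%N -> mgcd_prune r (M m) (x m) <> finset.set0) ->
        M n.+1 = mgcd_prune r (M n) (x n) /\
        exists j, [/\ j \in mgcd_prune r (M n) (x n),
          forall i, i \in mgcd_prune r (M n) (x n) ->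
            f (mgcd_next r j (x n)) <= f (mgcd_next r i (x n)) &
          x n.+1 = mgcd_next r j (x n)]].

Arguments mgcd_run {R d} f r x0 x M.

Definition mgcd_stops_at (R : realType) (d : nat) (r : max_min_rep R d)
    (x : nat -> 'rV[R]_d) (M : nat -> {set 'I_(rep_s r).+1}) (N : nat) : Prop :=
  mgcd_prune r (M N) (x N) = finset.set0 /\
  forall n, (n < N)%N -> mgcd_prune r (M n) (x n) <> finset.set0.

Arguments mgcd_stops_at {R d} r x M N.

Definition global_minimizer (R : realType) (d : nat) (f : 'rV[R]_d -> R)
    (x : 'rV[R]_d) : Prop :=
  forall y, f x <= f y.

(* Main.v *)
Require Import Defs.
From mathcomp Require Import all_boot all_order all_algebra.
From mathcomp Require Import all_classical all_reals all_analysis.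
From mathcomp Require Import ring lra.

Set Implicit Arguments.
Unset Strict Implicit.
Unset Printing Implicit Defensive.

Import Order.TTheory GRing.Theory Num.Theory.
Import numFieldNormedType.Exports.

Local Open Scope classical_set_scope.
Local Open Scope ring_scope.

(** A minimum exists because on each member of the partition f is an affine
function bounded below on a nonempty polyhedron. Such a function attains its
minimum there: every feasible point can be moved, without increasing the
objective, to a point where the objective is constant on the affine subspace
cut out by the active constraints ([saturate]). The value at such a point
depends only on its active set, so only finitely many values compete.

For the method, write f = min_j f_j, where the convex function
f_j(x) = max_i (a_i + b_j + <v_i + w_j, x>) is [piece j]. The polytope searched
at x for the index j has the vertices (g_i, u_i), where g_i is the value of the
i-th affine branch of f_j at x minus f(x), and u_i = v_i + w_j. Its point of
least norm (a, v) satisfies a g_i + <v, u_i> >= a^2 + |v|^2 for all i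
([min_norm_variational]), with equality wherever the vertex i carries weight
([min_norm_face]). Three consequences give the theorem.

- If a >= 0, then f_j >= f(x) everywhere: a point z with f_j(z) < f(x) would
  give a direction along which all the branches decrease, against the lower
  bound ([piece_ge_of_nonneg]). As f decreases along the iterates, a removed
  index stays harmless, and when no index is left x minimizes f.

- If a < 0, then the next point y = x + v / a satisfies
  f_j(y) <= f(x) + (a^2 + |v|^2) / a < f(x) ([piece_next_le]).

- If a < 0, let S be the set of vertices on the face through (a, v); then v lies
  in the convex hull of the slopes u_i, i in S. If this hull contains 0, then y
  minimizes f_j. Otherwise |v| is at least the distance e > 0 from 0 to the hull,
  and |a| + |v|^2 / |a| >= e. There are finitely many pairs (j, S), so e can be
  chosen once for all ([next_minimizes_or_descends]).

So a step made with the index j either lands on a minimizer of f_j, after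
which j is removed, or lowers f by at least e. The quantity f(x_n) + e |M_n|,
with M_n the set of indices kept at x_n, therefore drops by at least e at each
step. It is bounded below, so the method stops. *)

(** * The scalar product *)

Section Dot.
Variables (R : realType) (d : nat).
Implicit Types (x y z : 'rV[R]_d) (s : R).

Lemma dotC x y : dot x y = dot y x.
Proof. by apply: eq_bigr => k _; rewrite mulrC. Qed.

Lemma dotDl x y z : dot (x + y) z = dot x z + dot y z.
Proof. by rewrite -big_split; apply: eq_bigr => k _; rewrite mxE mulrDl. Qed.

Lemma dotZl s x y : dot (s *: x) y = s * dot x y.
Proof. by rewrite mulr_sumr; apply: eq_bigr => k _; rewrite mxE mulrA. Qed.

Lemma dotDr x y z : dot z (x + y) = dot z x + dot z y.
Proof. by rewrite dotC dotDl !(dotC z). Qed.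

Lemma dotZr s x y : dot x (s *: y) = s * dot x y.
Proof. by rewrite dotC dotZl dotC. Qed.

Lemma dotNr x y : dot x (- y) = - dot x y.
Proof. by rewrite -scaleN1r dotZr mulN1r. Qed.

Lemma dotBr x y z : dot z (x - y) = dot z x - dot z y.
Proof. by rewrite dotDr dotNr. Qed.

Lemma dot0l x : dot 0 x = 0.
Proof. by rewrite -(scale0r 0) dotZl mul0r. Qed.

Lemma dot_ge0 x : 0 <= dot x x.
Proof. by apply: sumr_ge0 => k _; rewrite -expr2 sqr_ge0. Qed.

Lemma dot_eq0 x : (dot x x == 0) = (x == 0).
Proof.
apply/idP/eqP => [|->]; last by rewrite dot0l.
rewrite psumr_eq0 => [/allP x0|k _]; last by rewrite -expr2 sqr_ge0.
apply/rowP => k; rewrite mxE; apply/eqP.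
by have := x0 k (mem_index_enum _); rewrite /= mulf_eq0 orbb.
Qed.

End Dot.

(** * Linear functions bounded below on a polyhedron *)

Section LinearProgram.
Variables (R : realType) (d m : nat) (c : 'I_m -> 'rV[R]_d) (t : 'I_m -> R).
Variables (v : 'rV[R]_d) (low : R).

Let feasible (x : 'rV[R]_d) := forall k, dot (c k) x <= t k.

Definition active (x : 'rV[R]_d) : {set 'I_m} := [set k | dot (c k) x == t k]%SET.

Hypothesis bounded : forall x, feasible x -> low <= dot v x.

(** These points play the role of vertices. Asking for constancy of the objective
on the active subspace, rather than for an extreme point, also covers polyhedra
that contain lines and so have no vertex. *)
Definition saturated (x : 'rV[R]_d) : Prop :=
  feasible x /\
  forall y, (forall k, k \in active x -> dot (c k) y = t k) -> dot v y = dot v x.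

(** The objective decreases along h, so by boundedness the ray from x in the
direction h leaves the polyhedron; the exit point meets a new constraint. *)
Lemma ratio_test (x h : 'rV[R]_d) :
  feasible x -> dot v h < 0 -> (forall k, k \in active x -> dot (c k) h = 0) ->
  exists x', [/\ feasible x', dot v x' <= dot v x & (active x \proper active x')%SET].
Proof.
move=> fx vh ch.
have [/existsP[k0 k0P]|] := boolP [exists k, 0 < dot (c k) h]; last first.
  rewrite negb_exists => /forallP hle.
  have fs s : 0 <= s -> feasible (x + s *: h).
    move=> s0 k; rewrite dotDr dotZr.
    have := hle k; rewrite -leNgt => hk.
    have := fx k; have := mulr_ge0_le0 s0 hk; lra.
  have lx := bounded fx.
  (* This multiple of h brings the objective down to low - 1. *)
  have s0 : 0 <= (dot v x - low + 1) / - dot v h.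
    by apply: divr_ge0; lra.
  have := bounded (fs _ s0); rewrite dotDr dotZr invrN mulrN mulNr divfK ?lt_eqF//.
  lra.
pose step k := (t k - dot (c k) x) / dot (c k) h.
case: (@arg_minP _ _ _ k0 (fun k => 0 < dot (c k) h) step k0P) => k1 k1P k1min.
have s0 : 0 <= step k1 by rewrite divr_ge0 ?subr_ge0 ?(ltW k1P).
exists (x + step k1 *: h); split.
- move=> k; rewrite dotDr dotZr.
  have [hk|hk] := ltP 0 (dot (c k) h).
    have := k1min k hk; rewrite {2}/step ler_pdivlMr//; lra.
  by have := fx k; have := mulr_ge0_le0 s0 hk; lra.
- by rewrite dotDr dotZr; have := mulr_ge0_le0 s0 (ltW vh); lra.
- rewrite properE; apply/andP; split.
    apply/fintype.subsetP => k kx; rewrite inE dotDr dotZr ch// mulr0 addr0.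
    by move: kx; rewrite inE.
  apply/fintype.subsetPn; exists k1.
    have c0 : dot (c k1) h != 0 by rewrite gt_eqF.
    by rewrite inE dotDr dotZr /step divfK// addrC subrK.
  by apply/negP => /ch h0; move: k1P; rewrite h0 ltxx.
Qed.

(** If the objective varies on the active subspace of x, then it decreases along
some direction of that subspace, and the ratio test enlarges the active set,
which can happen at most m times. *)
Lemma saturate (x : 'rV[R]_d) :
  feasible x -> exists2 x', saturated x' & dot v x' <= dot v x.
Proof.
have [n] := ubnP (m - #|active x|); elim: n x => // n IH x cx fx.
have [sx|] := pselect (saturated x); first by exists x.
move=> /not_andP[//|/existsNP[y /not_implyP[yx /eqP vyx]]].
have dir k : k \in active x -> dot (c k) (y - x) = 0.
  move=> kx; rewrite dotBr yx//; move: kx; rewrite inE => /eqP ->; exact: subrr.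
have [h vh hx] : exists2 h, dot v h < 0 &
    forall k, k \in active x -> dot (c k) h = 0.
  have [lt|gt|eq] := ltgtP (dot v y) (dot v x); last by rewrite eq eqxx in vyx.
    by exists (y - x) => //; rewrite dotBr subr_lt0.
  exists (- (y - x)); first by rewrite dotNr dotBr oppr_lt0 subr_gt0.
  by move=> k kx; rewrite dotNr dir// oppr0.
have [x1 [fx1 vx1 /proper_card ax1]] := ratio_test fx vh hx.
have [] := IH x1 _ fx1.
  have : (#|active x1| <= m)%N by rewrite -[leqRHS]card_ord max_card.
  move: cx ax1; rewrite ltnS => cx ax1 am; apply: leq_trans cx.
  exact: ltn_sub2l (leq_trans ax1 am) ax1.
by move=> x2 sx2 x21; exists x2 => //; apply: le_trans x21 vx1.
Qed.

(** The objective takes one value at all saturated points with a given active set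
K, so the minimum is found among the finitely many sets K that occur. *)
Lemma linear_program_attained (x0 : 'rV[R]_d) :
  feasible x0 -> exists2 x, feasible x & forall y, feasible y -> dot v x <= dot v y.
Proof.
move=> fx0.
pose P (K : {set 'I_m}) := `[< exists2 x, saturated x & active x = K >].
pose val (K : {set 'I_m}) :=
  dot v (xget 0 [set x | saturated x /\ active x = K]).
have valE x : saturated x -> val (active x) = dot v x.
  move=> sx; rewrite /val; case: xgetP => [y _ [sy ay]|/(_ x)]; last by case.
  by apply: sx.2 => k; rewrite -ay inE => /eqP.
have [x1 sx1 _] := saturate fx0.
have P1 : P (active x1) by apply/asboolP; exists x1.
case: (@arg_minP _ _ _ _ P val P1) => K /asboolP[x sx <-] Kmin.
exists x; first exact: sx.1.
move=> y /saturate[y' sy' y'y]; apply: le_trans y'y.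
by rewrite -!valE//; apply: Kmin; apply/asboolP; exists y'.
Qed.

End LinearProgram.


Lemma piecewise_affine_attains_min (R : realType) (d : nat) (f : 'rV[R]_d -> R) :
  piecewise_affine f -> has_lbound (range f) -> exists x, global_minimizer f x.
Proof.
move=> [k [Q [Qpoly Qcover Qint _] Qaff]] [low fl].
have flow x : low <= f x by apply: fl; exists x.
have Qmin i : exists2 x, Q i x & forall y, Q i y -> f x <= f y.
  have [m [H [Hhalf QE]]] := Qpoly i.
  have [c cP] := choice Hhalf.
  have [t tP] := choice cP.
  have Qfeas x : Q i x <-> forall l, dot (c l) x <= t l.
    rewrite QE; split=> [Qx l|fx l _]; last by rewrite (tP l).2; apply: fx.
    by have := Qx l I; rewrite (tP l).2.
  have [a [v fE]] := Qaff i.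
  have [x0 /interior_subset Qx0] := Qint i.
  have vlow x : (forall l, dot (c l) x <= t l) -> low - a <= dot v x.
    by move=> /Qfeas /fE fx; have := flow x; rewrite fx; lra.
  have [x /Qfeas Qx xmin] := linear_program_attained vlow ((Qfeas x0).1 Qx0).
  exists x => // y Qy; rewrite !fE// lerD2l; apply: xmin; exact/Qfeas.
have [xm xmP] := choice (fun i => (exists2P _ _).1 (Qmin i)).
have [i0 _ _] : (\bigcup_(i in [set: 'I_k]) Q i) 0 by rewrite Qcover.
case: (@arg_minP _ _ _ i0 xpredT (fun i => f (xm i)) isT) => i _ imin.
exists (xm i) => y.
have [j _ Qjy] : (\bigcup_(i in [set: 'I_k]) Q i) y by rewrite Qcover.
exact: le_trans (imin j isT) ((xmP j).2 _ Qjy).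
Qed.

(** * Points of least norm in polytopes *)

Definition face_hull (R : realType) (V : lmodType R) (n : nat) (p : 'I_n -> V)
    (S : {set 'I_n}) : set V :=
  [set q | exists t : 'I_n -> R,
    [/\ forall i, 0 <= t i, \sum_i t i = 1, forall i, i \notin S -> t i = 0 &
        q = \sum_i t i *: p i]].

Lemma face_hullT (R : realType) (V : lmodType R) (n : nat) (p : 'I_n -> V) :
  face_hull p [set: 'I_n]%SET = convex_hull p.
Proof.
apply/seteqP; split=> q [t]; first by move=> [t0 t1 _ ->]; exists t.
by move=> [t0 t1 ->]; exists t; split=> // i; rewrite inE.
Qed.

Lemma convex_hull_vertex (R : realType) (V : lmodType R) (n : nat)
    (p : 'I_n -> V) i : convex_hull p (p i).
Proof.
exists (fun k => (k == i)%:R); split=> [k||]; first exact: ler0n.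
  by rewrite (bigD1 i)//= eqxx big1 ?addr0// => k /negPf ->.
by rewrite (bigD1 i)//= eqxx scale1r big1 ?addr0// => k /negPf ->; rewrite scale0r.
Qed.

Lemma convex_hull_segment (R : realType) (V : lmodType R) (n : nat)
    (p : 'I_n -> V) (q1 q2 : V) (s : R) : convex_hull p q1 -> convex_hull p q2 ->
  0 <= s <= 1 -> convex_hull p ((1 - s) *: q1 + s *: q2).
Proof.
move=> [t1 [t1_ge0 t1_sum ->]] [t2 [t2_ge0 t2_sum ->]] /andP[s0 s1].
exists (fun i => (1 - s) * t1 i + s * t2 i); split=> [i||].
- by rewrite addr_ge0// mulr_ge0// subr_ge0.
- by rewrite big_split/= -!mulr_sumr t1_sum t2_sum; ring.
- rewrite !scaler_sumr -big_split/=; apply: eq_bigr => i _.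
  by rewrite !scalerA -scalerDl.
Qed.

Lemma convex_hull_translate (R : realType) (V : lmodType R) (n : nat)
    (p : 'I_n -> V) (z : V) :
  [set q + z | q in convex_hull p] = convex_hull (fun i => p i + z).
Proof.
have shift (t : 'I_n -> R) : \sum_i t i = 1 ->
    \sum_i t i *: (p i + z) = \sum_i t i *: p i + z.
  move=> t1; under eq_bigr do rewrite scalerDr.
  by rewrite big_split/= -scaler_suml t1 scale1r.
apply/seteqP; split=> [_ [_ [t [t0 t1 ->]] <-]|_ [t [t0 t1 ->]]].
  by exists t; rewrite shift.
by exists (\sum_i t i *: p i); [exists t|rewrite shift].
Qed.

Section CodiffSpace.
Variables (R : realType) (d n : nat).
Implicit Types (p : 'I_n -> codiff_space R d) (q : codiff_space R d).

Definition codot (q q' : codiff_space R d) : R := q.1 * q'.1 + dot q.2 q'.2.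

Lemma comb1 p (t : 'I_n -> R) : (\sum_i t i *: p i).1 = \sum_i t i * (p i).1.
Proof. by rewrite raddf_sum. Qed.

Lemma comb2 p (t : 'I_n -> R) : (\sum_i t i *: p i).2 = \sum_i t i *: (p i).2.
Proof. by rewrite raddf_sum. Qed.

Lemma dot_sumr (u : 'I_n -> 'rV[R]_d) (t : 'I_n -> R) (x : 'rV[R]_d) :
  dot x (\sum_i t i *: u i) = \sum_i t i * dot x (u i).
Proof.
rewrite (@big_morph _ _ (dot x) 0 +%R _ _ (fun y z => dotDr y z x)).
  by apply: eq_bigr => i _; rewrite dotZr.
by rewrite dotC dot0l.
Qed.

Lemma codot_comb q p (t : 'I_n -> R) : codot q (\sum_i t i *: p i) = \sum_i t i * codot q (p i).
Proof.
rewrite /codot comb1 comb2 dot_sumr mulr_sumr -big_split.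
by apply: eq_bigr => i _ /=; ring.
Qed.

Lemma codotqq q : codot q q = sqnorm q.
Proof. by rewrite /codot -expr2. Qed.

Lemma continuous_sum (T : topologicalType) (m : nat) (F : 'I_m -> T -> R) :
  (forall i, continuous (F i)) -> continuous (fun x => \sum_i F i x).
Proof.
elim: m F => [|m IH] F cF x.
  by under eq_fun do rewrite big_ord0; exact: cvg_cst.
under eq_fun do rewrite big_ord_recl.
apply: (@continuousD _ _ _ (F ord0)); first exact: cF.
exact: (IH (fun i => F (lift ord0 i)) (fun i => cF _)).
Qed.

Lemma continuous_weighted (c : 'I_n -> R) :
  continuous (fun t : 'rV[R]_n => \sum_i t 0 i * c i).
Proof.
apply: continuous_sum => i t.
by apply: continuousM; [exact: coord_continuous|exact: cst_continuous].
Qed.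

Lemma continuous_weighted_sqr (c : 'I_n -> R) :
  continuous (fun t : 'rV[R]_n => (\sum_i t 0 i * c i) ^+ 2).
Proof.
by move=> t; under eq_fun do rewrite expr2; apply: continuousM; exact: continuous_weighted.
Qed.

(** The coefficients range over a compact part of the cube, and the norm of the
combination depends continuously on them. *)
Lemma face_hull_min_norm p (S : {set 'I_n}) :
  face_hull p S !=set0 -> exists q, is_min_norm (face_hull p S) q.
Proof.
pose W := [set t : 'rV[R]_n | [/\ forall i, 0 <= t 0 i, \sum_i t 0 i = 1 &
  forall i, i \notin S -> t 0 i = 0]].
pose comb (t : 'rV[R]_n) := \sum_i t 0 i *: p i.
have hullW q : face_hull p S q -> exists2 t, W t & q = comb t.
  move=> [t [t0 t1 tS ->]]; exists (\row_i t i).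
    split=> [i||i iS]; rewrite ?mxE//; last exact: tS.
    by under eq_bigr do rewrite mxE.
  by apply: eq_bigr => i _; rewrite mxE.
have Whull t : W t -> face_hull p S (comb t).
  by move=> [t0 t1 tS]; exists (fun i => t 0 i).
move=> [_ /hullW[t0 Wt0 _]].
have preim (F : 'rV[R]_n -> R) (D : set R) :
    continuous F -> closed D -> closed (F @^-1` D).
  by move=> cF; apply: preimage_closed => t _; exact: cF.
have cW : compact W.
  have box : compact [set t : 'rV[R]_n | forall i, t ord0 i \in `[0, 1]].
    by apply: (@rV_compact _ _ (fun=> `[0 : R, 1]%classic)) => i; exact: segment_compact.
  apply: (subclosed_compact _ box); last first.
    move=> t [tge0 t1 _] i /=; rewrite in_itv/= tge0/= -t1 (bigD1 i)//=.
    by rewrite lerDl sumr_ge0.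
  rewrite (_ : W = (\bigcap_(i in [set: 'I_n]) [set t : 'rV[R]_n | 0 <= t 0 i])
     `&` [set t : 'rV[R]_n | \sum_i t 0 i = 1]
     `&` (\bigcap_(i in [set i | i \notin S]) [set t : 'rV[R]_n | t 0 i = 0])).
    apply: closedI; [apply: closedI|].
    - apply: closed_bigI => i _.
      apply: (preim (fun t => t 0 i) [set x | 0 <= x]); last exact: closed_ge.
      exact: coord_continuous.
    - apply: (preim (fun t => \sum_i t 0 i) [set x | x = 1]); last exact: closed_eq.
      by apply: continuous_sum => i; exact: coord_continuous.
    - apply: closed_bigI => i _.
      apply: (preim (fun t => t 0 i) [set x | x = 0]); last exact: closed_eq.
      exact: coord_continuous.
  apply/seteqP; split=> t.
    by move=> [tge0 t1 tS]; split; [split=> // i _; exact: tge0|exact: tS].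
  by move=> [[tge0 t1] tS]; split=> // i; exact: tge0.
have cN : continuous (fun t => sqnorm (comb t)).
  have -> : (fun t => sqnorm (comb t)) = (fun t : 'rV[R]_n =>
     (\sum_i t 0 i * (p i).1) ^+ 2 +
     \sum_k (\sum_i t 0 i * (p i).2 0 k) ^+ 2).
    apply: funext => t; rewrite /sqnorm comb1 comb2; congr (_ + _).
    apply: eq_bigr => k _; rewrite -expr2 summxE; congr (_ ^+ 2).
    by apply: eq_bigr => i _; rewrite mxE.
  move=> t; pose csq c := @continuous_weighted_sqr c.
  have csum := @continuous_sum _ _ _ (fun k => csq (fun i => (p i).2 0 k)).
  exact: (continuousD (csq (fun i => (p i).1) t) (csum t)).
have [t Wt tmin] : exists2 t, t \in W &
    forall t', t' \in W -> sqnorm (comb t) <= sqnorm (comb t').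
  apply: EVT_min_rV => //; [by exists t0|exact: continuous_subspaceT].
exists (comb t); split=> [|_ /hullW[t' Wt' ->]]; first by apply: Whull; rewrite inE in Wt.
by apply: tmin; rewrite inE.
Qed.

(** Otherwise moving from q slightly towards the vertex p i would shorten q. *)
Lemma min_norm_variational p q i :
  is_min_norm (convex_hull p) q -> sqnorm q <= codot q (p i).
Proof.
move=> [qp qmin]; rewrite leNgt; apply/negP => lt.
pose D := sqnorm (p i - q).
have D0 : 0 <= D by rewrite addr_ge0 ?sqr_ge0 ?dot_ge0.
have expand s : sqnorm ((1 - s) *: q + s *: p i) =
    sqnorm q - 2 * s * (sqnorm q - codot q (p i)) + s ^+ 2 * D.
  rewrite /D /sqnorm /codot /= !(dotDr, dotDl, dotZl, dotZr, dotNr).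
  rewrite [dot (- q.2) _]dotC dotNr (dotC (p i).2 q.2) [dot (- q.2) _]dotC dotNr.
  rewrite /GRing.scale/=; ring.
pose e := sqnorm q - codot q (p i).
have e0 : 0 < e by rewrite subr_gt0.
(* The norm changes by - 2 s e + s^2 D, which is negative for this s. *)
pose s := e / (e + D).
have eD : 0 < e + D by rewrite ltr_pwDl.
have s0 : 0 < s by rewrite divr_gt0.
have s1 : s <= 1 by rewrite ler_pdivrMr// mul1r lerDl.
have s01 : 0 <= s <= 1 by rewrite ltW.
have := qmin _ (convex_hull_segment qp (convex_hull_vertex p i) s01).
rewrite expand -/e.
have sD : s * D <= e by have : s * (e + D) = e; [rewrite divfK ?gt_eqF|nra].
nra.
Qed.

(** Complementary slackness: the average of the numbers codot q (p k), taken with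
the weights of q, equals sqnorm q, and none of them is smaller, so every vertex
of positive weight attains equality. *)
Lemma min_norm_face p q : is_min_norm (convex_hull p) q ->
  face_hull p [set i | codot q (p i) == sqnorm q]%SET q.
Proof.
move=> qmin; have [[t [t0 t1 qE]] _] := qmin.
exists t; split=> // i; rewrite inE => ni.
have : \sum_k t k * (codot q (p k) - sqnorm q) = 0.
  under eq_bigr do rewrite mulrBr.
  by rewrite sumrB -mulr_suml t1 mul1r -codot_comb -qE codotqq subrr.
move=> /eqP; rewrite psumr_eq0 => [/allP /(_ i (mem_index_enum _))|k _].
  by rewrite /= mulf_eq0 subr_eq0 (negPf ni) orbF => /eqP.
by rewrite mulr_ge0// subr_ge0 min_norm_variational.
Qed.

End CodiffSpace.

(** * A uniform descent constant *)

Lemma uniform_gap (R : realType) (T : finType) (P : T -> R -> Prop) :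
  (forall i, exists2 e, 0 < e & P i e) ->
  (forall i e e', 0 < e' <= e -> P i e -> P i e') ->
  exists2 e, 0 < e & forall i, P i e.
Proof.
move=> Pe Pmono.
have [e eP] := choice (fun i => (exists2P _ _).1 (Pe i)).
exists (\big[Order.min/1]_i e i).
  elim/big_ind: _ => //= [a b a0 b0|i _]; first by rewrite lt_min a0.
  exact: (eP i).1.
move=> i; apply: (Pmono i (e i)); last exact: (eP i).2.
apply/andP; split; last exact: bigmin_le_cond.
elim/big_ind: _ => //= [a b a0 b0|k _]; first by rewrite lt_min a0.
exact: (eP k).1.
Qed.

(** The hull is compact, so its distance from 0 is positive unless it contains 0.
An empty hull satisfies the second alternative. *)
Lemma slope_gap (R : realType) (d n : nat) (u : 'I_n -> 'rV[R]_d) (S : {set 'I_n}) :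
  exists2 e : R, 0 < e &
    (face_hull u S 0 \/ forall v, face_hull u S v -> e ^+ 2 <= dot v v).
Proof.
pose p i : codiff_space R d := (0, u i).
have pE (t : 'I_n -> R) : \sum_i t i *: p i = (0, \sum_i t i *: u i).
  rewrite [LHS]surjective_pairing comb1 comb2; congr pair.
  by apply: big1 => i _; exact: mulr0.
have up v : face_hull u S v -> face_hull p S (0, v).
  by move=> [t [t0 t1 tS ->]]; exists t; rewrite pE.
have [[v0 uv0]|none] := pselect (face_hull u S !=set0); last first.
  by exists 1 => //; right=> v uv; case: none; exists v.
have [|_ [[t [t0 t1 tS ->]] tmin]] := @face_hull_min_norm _ _ _ p S.
  by exists (0, v0); exact: up.
set v := \sum_i t i *: u i.
have uv : face_hull u S v by exists t.
have [v_eq0|v_neq0] := eqVneq v 0; first by exists 1 => //; left; rewrite -v_eq0.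
have vv0 : 0 < dot v v by rewrite lt0r dot_eq0 v_neq0 dot_ge0.
exists (Num.sqrt (dot v v)); first by rewrite sqrtr_gt0.
right=> v' /up /tmin; rewrite pE /sqnorm /= expr0n !add0r sqr_sqrtr//.
exact: ltW.
Qed.

(** * One step of the method *)

Section ConvexPieces.
Variables (R : realType) (d : nat) (f : 'rV[R]_d -> R) (r : max_min_rep R d).
Variable low : R.
Hypothesis f_rep : represents r f.
Hypothesis f_low : forall x, low <= f x.

Notation I := 'I_(rep_l r).+1.
Notation J := 'I_(rep_s r).+1.

Definition piece (j : J) (x : 'rV[R]_d) : R :=
  lower_part r x + (rep_b r j + dot (rep_w r j) x).

Definition branch (j : J) (i : I) (x : 'rV[R]_d) : R :=
  rep_a r i + dot (rep_v r i) x + (rep_b r j + dot (rep_w r j) x).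

Definition slope (j : J) (i : I) : 'rV[R]_d := rep_v r i + rep_w r j.

Definition vertex (j : J) (x : 'rV[R]_d) (i : I) : codiff_space R d :=
  (branch j i x - f x, slope j i).

Lemma f_le_piece j x : f x <= piece j x.
Proof. by rewrite f_rep lerD2l; exact: bigmin_le_cond. Qed.

Lemma le_f_piece c x : (forall j, c <= piece j x) -> c <= f x.
Proof.
move=> cj; rewrite f_rep -lerBlDl; apply: le_bigmin => [|j _].
  by rewrite lerBlDl; exact: cj.
by rewrite lerBlDl; exact: cj.
Qed.

Lemma branch_le_piece j i x : branch j i x <= piece j x.
Proof. by rewrite lerD2r; exact: le_bigmax_cond. Qed.

Lemma piece_le_branch j c x : (forall i, branch j i x <= c) -> piece j x <= c.
Proof.
move=> cj; rewrite -lerBrDr; apply: bigmax_le => [|i _].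
  by rewrite lerBrDr; exact: cj.
by rewrite lerBrDr; exact: cj.
Qed.

Lemma branch_shift j i x h : branch j i (x + h) = branch j i x + dot (slope j i) h.
Proof. by rewrite /branch /slope !dotDr dotDl; ring. Qed.

(** The shifts by the two parts of f combine: the polytope of the method is the
convex hull of the vertices of the piece j, measured from the value f x. *)
Lemma min_norm_pointP j x :
  is_min_norm (convex_hull (vertex j x)) (min_norm_point r j x).
Proof.
have hullE : [set p + hyper_point r j x | p in hypodiff r x] =
    convex_hull (vertex j x).
  rewrite convex_hull_translate; congr convex_hull; apply: funext => i.
  by congr pair; rewrite /branch f_rep /=; ring.
rewrite /min_norm_point hullE; case: xgetP => [//|none].
have [|q] := @face_hull_min_norm _ _ _ (vertex j x) [set: I]%SET.
  by rewrite face_hullT; exists (vertex j x ord0); exact: convex_hull_vertex.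
by rewrite face_hullT => /none.
Qed.

Let q j x := min_norm_point r j x.

(** Suppose piece j z < f x and put h = z - x, so that g_i + <u_i, h> < 0 for every
vertex (g_i, u_i). If the point (a, v) of least norm is 0, then 0 is an average
of these vertices, and averaging the inequalities gives 0 < 0. Otherwise, as
a >= 0, <u_i, v - a h> >= a g_i + <u_i, v> >= |(a, v)|^2 > 0, so all the branches
decrease at a uniform rate along a h - v and the piece is unbounded below. *)
Lemma piece_ge_of_nonneg j x : 0 <= (q j x).1 -> forall z, f x <= piece j z.
Proof.
move=> a_ge0 z; rewrite leNgt; apply/negP => zx.
have qmin := min_norm_pointP j x; rewrite -/(q j x) in qmin.
have neg i : branch j i x - f x + dot (slope j i) (z - x) < 0.
  have := branch_le_piece j i z.
  by rewrite -{1}(subrKC x z) branch_shift; lra.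
have var i := min_norm_variational i qmin.
have [n0|n_neq0] := eqVneq (sqnorm (q j x)) 0.
  have [[t [t0 t1 qE]] _] := qmin.
  have : codot (1, z - x) (q j x) = 0.
    move/eqP: n0; rewrite /sqnorm paddr_eq0 ?sqr_ge0 ?dot_ge0// sqrf_eq0 dot_eq0.
    by move=> /andP[/eqP q1 /eqP q2]; rewrite /codot q1 q2 mulr0 dotC dot0l addr0.
  rewrite qE codot_comb => /eqP.
  have codot_lt0 i : codot (1, z - x) (vertex j x i) < 0.
    by rewrite /codot mul1r dotC; exact: neg.
  have pos i : 0 <= - (t i * codot (1, z - x) (vertex j x i)).
    by rewrite -mulrN mulr_ge0// oppr_ge0 ltW.
  rewrite -oppr_eq0 -sumrN psumr_eq0// => /allP tn.
  move: t1; rewrite big1 => [/eqP|i _]; first by rewrite eq_sym oner_eq0.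
  have := tn i (mem_index_enum _); rewrite /= oppr_eq0 mulf_eq0 => /orP[/eqP//|].
  by rewrite lt_eqF.
have n_gt0 : 0 < sqnorm (q j x).
  by rewrite lt0r n_neq0 addr_ge0 ?sqr_ge0 ?dot_ge0.
pose k := - ((q j x).2 - (q j x).1 *: (z - x)).
have down i : dot (slope j i) k <= - sqnorm (q j x).
  rewrite /k dotNr dotBr dotZr lerN2 (dotC _ (q j x).2).
  have := var i; rewrite /codot /=; have := mulr_ge0_le0 a_ge0 (ltW (neg i)); lra.
(* This multiple of k brings the piece down to low - 1. *)
pose s := (piece j x - low + 1) / sqnorm (q j x).
have s0 : 0 <= s.
  rewrite divr_ge0 ?(ltW n_gt0)//.
  by have := f_low x; have := f_le_piece j x; lra.
have sn : s * sqnorm (q j x) = piece j x - low + 1 by rewrite divfK.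
have : piece j (x + s *: k) <= piece j x - s * sqnorm (q j x).
  apply: piece_le_branch => i; rewrite branch_shift dotZr -mulrN.
  by rewrite lerD ?branch_le_piece// ler_wpM2l.
have := f_low (x + s *: k); have := f_le_piece j (x + s *: k); lra.
Qed.

(** Dividing the variational inequality by a < 0 bounds every branch of the piece
at x + v / a. *)
Lemma piece_next_le j x : (q j x).1 < 0 ->
  piece j (mgcd_next r j x) <= f x + sqnorm (q j x) / (q j x).1.
Proof.
move=> a_lt0; apply: piece_le_branch => i.
rewrite branch_shift dotZr (dotC (slope j i)) -/(q j x).
have := min_norm_variational i (min_norm_pointP j x); rewrite -/(q j x) /codot /=.
move: a_lt0; set a := (q j x).1; set n := sqnorm _; set w := dot _ _ => a_lt0 var.
have -> : branch j i x + a^-1 * w = f x + (a * (branch j i x - f x) + w) / a.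
  by field; rewrite lt_eqF.
by rewrite lerD2l ler_wnM2r// invr_le0 ltW.
Qed.

Lemma piece_next_lt j x : (q j x).1 < 0 -> piece j (mgcd_next r j x) < f x.
Proof.
move=> a_lt0; apply: le_lt_trans (piece_next_le a_lt0) _.
rewrite gtrDl pmulr_rlt0 ?invr_lt0//.
by rewrite ltr_pwDl ?dot_ge0// exprn_even_gt0//= lt_eqF.
Qed.

(** With S the face through the point (a, v) of least norm, v is an average of the
slopes over S. If some average of these slopes vanishes, the same average of
the branches is a constant lower bound of the piece; on S the variational
inequality is an equality, so this constant is f x + |(a, v)|^2 / a, which the
next point reaches. Otherwise |v| >= e, and f decreases by |a| + |v|^2 / |a|. *)
Lemma next_minimizes_or_descends : exists2 e, 0 < e &
  forall j x, (q j x).1 < 0 ->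
    (forall z, piece j (mgcd_next r j x) <= piece j z) \/
    f (mgcd_next r j x) <= f x - e.
Proof.
have [|e e0 eP] := @uniform_gap R _ (fun jS e => face_hull (slope jS.1) jS.2 0 \/
    forall v, face_hull (slope jS.1) jS.2 v -> e ^+ 2 <= dot v v)
    (fun jS => slope_gap (slope jS.1) jS.2).
  move=> jS e e' /andP[e'0 e'e] [?|eP]; [by left|right=> v /eP].
  by apply: le_trans; rewrite !expr2; nra.
exists e => // j x a_lt0.
have qmin := min_norm_pointP j x; rewrite -/(q j x) in qmin.
pose S := [set i | codot (q j x) (vertex j x i) == sqnorm (q j x)]%SET.
have [[t [t0 t1 tS t_slope]]|gap] := eP (j, S).
  left=> z; apply: le_trans (piece_next_le a_lt0) _.
  have qt : codot (q j x) (\sum_i t i *: vertex j x i) = sqnorm (q j x).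
    rewrite codot_comb -[RHS]mul1r -t1 mulr_suml; apply: eq_bigr => i _.
    have [|/tS ->] := boolP (i \in S); last by rewrite !mul0r.
    by rewrite inE => /eqP ->.
  move: qt; rewrite /codot comb2 /= -t_slope dotC dot0l addr0 comb1 => <-.
  rewrite mulrAC mulfV ?lt_eqF// mul1r.
  have -> : f x + \sum_i t i * (vertex j x i).1 = \sum_i t i * branch j i z.
    have -> : \sum_i t i * branch j i z =
        \sum_i (t i * f x + t i * (vertex j x i).1 + t i * dot (z - x) (slope j i)).
      apply: eq_bigr => i _.
      by rewrite -{1}(subrKC x z) branch_shift (dotC (z - x)) /=; ring.
    by rewrite !big_split/= -dot_sumr -t_slope dotC dot0l addr0 -mulr_suml t1 mul1r.
  rewrite -[piece j z]mul1r -t1 mulr_suml; apply: ler_sum => i _.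
  by rewrite ler_wpM2l// branch_le_piece.
right; apply: le_trans (f_le_piece j _) _; apply: le_trans (piece_next_le a_lt0) _.
have /gap : face_hull (slope j) S (q j x).2.
  have [t [t0 t1 tS qE]] := min_norm_face qmin.
  by exists t; split=> //; rewrite [in LHS]qE comb2.
rewrite lerD2l /sqnorm; move: a_lt0; set a := (q j x).1; set w := dot _ _.
move=> a_lt0 ew; rewrite ler_ndivrMr//; nra.
Qed.

End ConvexPieces.

(** * Termination and optimality *)

Section Run.
Variables (R : realType) (d : nat) (f : 'rV[R]_d -> R) (r : max_min_rep R d).
Variable low : R.
Hypothesis f_rep : represents r f.
Hypothesis f_low : forall x, low <= f x.
Variables (x0 : 'rV[R]_d) (x : nat -> 'rV[R]_d).
Variable M : nat -> {set 'I_(rep_s r).+1}.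
Hypothesis run : mgcd_run f r x0 x M.

Let P n := mgcd_prune r (M n) (x n).

Lemma mem_prune n j : (j \in P n) = ((min_norm_point r j (x n)).1 < 0) && (j \in M n).
Proof. by rewrite !inE -ltNge. Qed.

Lemma run_step n : (forall m, (m <= n)%N -> P m <> finset.set0) ->
  M n.+1 = P n /\ exists2 j, j \in P n & x n.+1 = mgcd_next r j (x n).
Proof.
have [_ _ step] := run; move=> /step[ME [j [jP _ xE]]].
by split=> //; exists j.
Qed.

Lemma run_descends n : (forall m, (m <= n)%N -> P m <> finset.set0) ->
  f (x n.+1) < f (x n).
Proof.
move=> /run_step[_ [j jP ->]]; move: jP; rewrite mem_prune => /andP[a_lt0 _].
exact: le_lt_trans (f_le_piece f_rep j _) (piece_next_lt f_rep a_lt0).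
Qed.

(** An index is removed at a point where its piece lies above the value of f, and
f only decreases afterwards, so never restoring it is harmless. *)
Lemma pruned_pieces_above n : (forall m, (m < n)%N -> P m <> finset.set0) ->
  forall j, j \notin P n -> forall z, f (x n) <= piece j z.
Proof.
elim: n => [_|n IH Pn] j; rewrite mem_prune negb_and -leNgt.
  have [_ -> _] := run; rewrite inE orbF => a_ge0.
  exact: (piece_ge_of_nonneg f_rep f_low).
have Pn' m : (m <= n)%N -> P m <> finset.set0 by exact: Pn.
have [-> _] := run_step Pn'.
move=> /orP[a_ge0|jP] z; first exact: (piece_ge_of_nonneg f_rep f_low).
apply: le_trans (ltW (run_descends Pn')) _.
by apply: IH => // m mn; apply: Pn'; exact: ltnW.
Qed.

(** The potential phi drops by at least e at each step: either f drops by e, or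
the step lands on a minimizer of its piece. In the latter case the index j is
removed at the next point, since keeping it would send the piece below its
minimum. *)
Lemma run_stops : exists n, P n = finset.set0.
Proof.
have [e e0 eP] := next_minimizes_or_descends f_rep.
apply: contrapT => /forallNP never.
have Pn n m : (m <= n)%N -> P m <> finset.set0 by move=> _; exact: never.
pose phi n := f (x n) + #|P n|%:R * e.
have phi_drop n : phi n.+1 <= phi n - e.
  have [ME [j jP xE]] := run_step (Pn n).
  have sub : P n.+1 \subset P n by rewrite /P /mgcd_prune ME subsetDl.
  have := run_descends (Pn n).
  have := jP; rewrite mem_prune => /andP[a_lt0 _].
  have [jmin|fe] := eP _ _ a_lt0; last first.
    rewrite /phi xE => _; have : #|P n.+1|%:R * e <= #|P n|%:R * e.
      by rewrite ler_pM2r// ler_nat subset_leq_card.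
    lra.
  have jP' : j \notin P n.+1.
    rewrite mem_prune negb_and -leNgt; apply/orP; left; rewrite leNgt; apply/negP.
    move=> /(piece_next_lt f_rep); apply/negP; rewrite -leNgt.
    by apply: le_trans (f_le_piece f_rep j _) _; rewrite xE.
  have : (#|P n.+1|.+1 <= #|P n|)%N.
    by apply/proper_card/properP; split=> //; exists j.
  rewrite -(ler_nat R) -(ler_pM2r e0) -natr1 mulrDl mul1r /phi; lra.
have phi_le n : phi n <= phi 0%N - n%:R * e.
  elim: n => [|n IH]; first by rewrite mul0r subr0.
  by have := phi_drop n; rewrite -natr1 mulrDl mul1r; lra.
have phi_low n : low <= phi n.
  by rewrite ler_wpDr// mulr_ge0 ?ler0n ?ltW.
have nn : 0 <= (phi 0%N - low) / e by rewrite divr_ge0 ?subr_ge0 ?(ltW e0).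
have := archi_boundP nn; rewrite ltr_pdivrMr//.
have := phi_le (Num.bound ((phi 0%N - low) / e)).
have := phi_low (Num.bound ((phi 0%N - low) / e)); lra.
Qed.

Lemma run_finds_minimizer : exists N, mgcd_stops_at r x M N /\ global_minimizer f (x N).
Proof.
have stops : exists n, P n == finset.set0.
  by have [n Pn] := run_stops; exists n; apply/eqP.
case: (ex_minnP stops) => N /eqP PN Nmin.
have before m : (m < N)%N -> P m <> finset.set0.
  by move=> mN /eqP /Nmin; rewrite leqNgt mN.
exists N; split=> // z; apply: (le_f_piece f_rep) => j.
by apply: (pruned_pieces_above before); rewrite PN inE.
Qed.

End Run.

Theorem theorem4p7 (R : realType) (d : nat) (f : 'rV[R]_d -> R)
    (f_pa : piecewise_affine f) (f_bounded_below : has_lbound (range f)) :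
  (exists xstar : 'rV[R]_d, global_minimizer f xstar) /\
  (forall r : max_min_rep R d, represents r f ->
   forall (x0 : 'rV[R]_d) (x : nat -> 'rV[R]_d)
     (M : nat -> {set 'I_(rep_s r).+1}),
   mgcd_run f r x0 x M ->
   exists N : nat, mgcd_stops_at r x M N /\ global_minimizer f (x N)).
Proof.
split; first exact: piecewise_affine_attains_min.
move=> r f_rep x0 x M run; have [low f_low] := f_bounded_below.
by apply: (run_finds_minimizer f_rep _ run) => z; apply: f_low; exists z.
Qed.
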